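(* Let $f\in\Omega_{\mathcal{A}}$ be given by $f(z)=z+\sum_{n=2}^\infty a_nz^n$ for $z\in\mathbb{D}$. Then for $|z|=r$, $$|f(z)|+|f'(z)||z|+\sum_{n=2}^\infty|a_n|r^n\leq d\left(f(0),\partial f(\mathbb{D})\right)\quad\text{for}\quad r\leq\frac{\sqrt{2}-1}{2}.$$ The number $(\sqrt{2}-1)/2$ is the best possible, i.e. it cannot be replaced by any larger number valid for all $f\in\Omega_{\mathcal{A}}$.
   Context: $\mathbb{D}=\{z\in\mathbb{C}:|z|<1\}$. $\mathcal{A}$ is the family of functions $f$ analytic in $\mathbb{D}$ with $f(0)=0$ and $f'(0)=1$. The class $\Omega_{\mathcal{A}}$ consists of all $f(z)=z+\sum_{n=2}^\infty a_nz^n\in\mathcal{A}$ with $\sum_{n=2}^\infty(n-1)|a_n|\leq 1/2$. $d(f(0),\partial f(\mathbb{D}))$ denotes the Euclidean distance between $f(0)$ and the boundary of $f(\mathbb{D})$. *)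

(* Defs.v *)
From Stdlib Require Export Reals.
From Coquelicot Require Export Coquelicot.

Open Scope R_scope.

Definition unit_disk (z : C) : Prop := Cmod z < 1.

Definition analytic_on_disk (f : C -> C) : Prop :=
  forall z : C, unit_disk z -> @ex_derive C_AbsRing C_NormedModule f z.

Definition class_A (f : C -> C) : Prop :=
  analytic_on_disk f /\ f (RtoC 0) = RtoC 0 /\ C_derive f (RtoC 0) = RtoC 1.

(* f(z) = z + sum_{n>=2} a_n z^n on the unit disk.  Sums over n >= 2 are indexed
   by n : nat with n + 2 in place of n; the values a 0 and a 1 are never used. *)
Definition expansion (f : C -> C) (a : nat -> C) : Prop :=
  forall z : C, unit_disk z ->
    @is_series C_AbsRing C_NormedModule
      (fun n : nat => (a (n + 2)%nat * z ^ (n + 2))%C) (f z - z)%C.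

(* Convergence is required separately because [Series] is a total function. *)
Definition Omega_A (f : C -> C) : Prop :=
  class_A f /\
  exists a : nat -> C,
    expansion f a /\
    ex_series (fun n : nat => (INR (n + 2) - 1) * Cmod (a (n + 2)%nat)) /\
    Series (fun n : nat => (INR (n + 2) - 1) * Cmod (a (n + 2)%nat)) <= 1 / 2.

Definition image_of_disk (f : C -> C) (w : C) : Prop :=
  exists z : C, unit_disk z /\ w = f z.

Definition boundary {T : UniformSpace} (E : T -> Prop) (w : T) : Prop :=
  forall P : T -> Prop, locally w P ->
    (exists u : T, P u /\ E u) /\ (exists v : T, P v /\ ~ E v).

(* An infimum in the extended reals; the distance to the empty set is +oo. *)
Definition dist_to_set (p : C) (E : C -> Prop) : Rbar :=
  Glb_Rbar (fun d : R => exists w : C, E w /\ d = Cmod (p - w)%C).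

Definition dist_to_boundary (f : C -> C) : Rbar :=
  dist_to_set (f (RtoC 0)) (@boundary C_UniformSpace (image_of_disk f)).

(* The inequality holds for every member of the class and every z in the unit
   disk with |z| = r <= rho.  The last series converges for such z. *)
Definition valid_radius (rho : R) : Prop :=
  forall (f : C -> C) (a : nat -> C),
    Omega_A f -> expansion f a ->
    forall (z : C) (r : R),
      unit_disk z -> Cmod z = r -> r <= rho ->
      Rbar_le
        (Finite (Cmod (f z) + Cmod (C_derive f z) * Cmod z
                 + Series (fun n : nat => Cmod (a (n + 2)%nat) * r ^ (n + 2))))
        (dist_to_boundary f).

(* Main.v *)
(** Put g(z) = f(z) - z.  Since n <= 2 (n - 1) for n >= 2, the hypothesis gives
    sum n |a_n| <= 1, so |g(z)| <= |z|^2 / 2 and g is p-Lipschitz on the disk of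
    radius p < 1.  For |w| < 1/2 the map z |-> w - g(z) is thus a contraction of
    a suitable disk, so f(D) contains the disk of radius 1/2 and the boundary is
    at distance at least 1/2.  Since n + 2 <= 4 (n - 1), the left-hand side is at
    most 2 r + sum (n + 2) |a_n| r^n <= 2 r + 2 r^2, which equals 1/2 at
    r = (sqrt 2 - 1) / 2.  All these bounds are equalities for z + z^2 / 2 at
    z = r, where -1/2 = f(-1) is a boundary point of the image. *)

Require Import Defs.
From Stdlib Require Import Reals Lra Lia.
From Coquelicot Require Import Coquelicot.

(** * Complex series: distance to the sum and domination by a real series *)

Lemma is_series_C_dist (u : nat -> C) (l : C) :
  @is_series C_AbsRing C_NormedModule u l ->
  is_lim_seq (fun n => Cmod (sum_n u n - l)%C) 0.
Proof.
intros H.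
assert (H1 : filterlim (fun n => minus (sum_n u n) l) eventually
  (@locally C_NormedModule (minus l l))).
{ apply (filterlim_comp_2 (sum_n u) (fun _ => opp l) plus (G := locally l)
    (H := locally (opp l)) H).
  - apply filterlim_const.
  - exact (filterlim_plus (V := C_NormedModule) l (opp l)). }
assert (H2 := filterlim_comp _ _ _ _ _ _ _ _ H1 (filterlim_norm (minus l l))).
replace (norm (minus l l)) with 0 in H2; [exact H2|].
change (0 = Cmod (l - l)%C).
replace (l - l)%C with (RtoC 0) by ring.
symmetry; exact Cmod_0.
Qed.

(** The triangle inequality bounds every partial sum; passing to the limit only costs the distance
    from the partial sum to [l], which tends to 0. *)
Lemma is_series_Cmod_le (u : nat -> C) (b : nat -> R) (l : C) (L : R) :
  @is_series C_AbsRing C_NormedModule u l -> is_series b L ->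
  (forall n, Cmod (u n) <= b n) -> Cmod l <= L.
Proof.
intros Hu Hb Hle.
assert (Hs : forall n, Cmod (sum_n u n) <= sum_n b n).
{ induction n as [|n IH].
  - rewrite !sum_O; apply Hle.
  - rewrite !sum_Sn.
    eapply Rle_trans; [apply Cmod_triangle|].
    apply Rplus_le_compat; [exact IH|apply Hle]. }
assert (H : Rbar_le (Cmod l) (L + 0)%R).
{ apply (is_lim_seq_le (fun _ => Cmod l)
    (fun n => sum_n b n + Cmod (sum_n u n - l)%C)).
  - intros n.
    replace l with (sum_n u n + - (sum_n u n - l))%C at 1 by ring.
    eapply Rle_trans; [apply Cmod_triangle|].
    rewrite Cmod_opp.
    apply Rplus_le_compat_r, Hs.
  - apply is_lim_seq_const.
  - apply is_lim_seq_plus'; [exact Hb|apply is_series_C_dist, Hu]. }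
simpl in H; lra.
Qed.

(** * Lipschitz bound for powers and the contraction principle on a closed disk *)

Lemma Cpow_lipschitz (z w : C) (p : R) (n : nat) :
  Cmod z <= p -> Cmod w <= p ->
  Cmod (z ^ (S n) - w ^ (S n))%C <= INR (S n) * p ^ n * Cmod (z - w)%C.
Proof.
intros Hz Hw.
induction n as [|n IH].
- rewrite !Cpow_1_r; simpl; lra.
- rewrite (Cpow_S z), (Cpow_S w).
  replace (z * z ^ S n - w * w ^ S n)%C
    with (z * (z ^ S n - w ^ S n) + w ^ S n * (z - w))%C by ring.
  eapply Rle_trans; [apply Cmod_triangle|].
  rewrite !Cmod_mult, Cmod_pow, (S_INR (S n)).
  assert (H0 := Cmod_ge_0 w). assert (H1 := Cmod_ge_0 z).
  assert (H2 := Cmod_ge_0 (z - w)%C).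
  assert (H3 := Cmod_ge_0 (z ^ S n - w ^ S n)%C).
  assert (H4 := Rmult_le_compat _ _ _ _ H1 H3 Hz IH).
  assert (H5 := Rmult_le_compat_r _ _ _ H2 (pow_incr _ _ (S n) (conj H0 Hw))).
  simpl (p ^ S n) in *; nra.
Qed.

(** Picard iteration from 0: successive increments are dominated by a geometric series of ratio [q],
    so the iterates converge, and the Lipschitz bound makes the limit a fixed point. *)
Lemma contraction_fixed_point (T : C -> C) (p q : R) :
  0 <= p -> 0 <= q < 1 ->
  (forall z, Cmod z <= p -> Cmod (T z) <= p) ->
  (forall z w, Cmod z <= p -> Cmod w <= p ->
     Cmod (T z - T w)%C <= q * Cmod (z - w)%C) ->
  exists z, Cmod z <= p /\ T z = z.
Proof.
intros Hp Hq HT HL.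
set (x := fun n => Nat.iter n T (RtoC 0)).
assert (Hx : forall n, Cmod (x n) <= p).
{ induction n as [|n IH].
  - simpl; rewrite Cmod_0; exact Hp.
  - apply HT, IH. }
set (d := fun n => (x (S n) - x n)%C).
assert (Hd : forall n, Cmod (d n) <= Cmod (d 0%nat) * q ^ n).
{ induction n as [|n IH].
  - simpl; lra.
  - eapply Rle_trans; [apply (HL _ _ (Hx (S n)) (Hx n))|].
    change (x (S n) - x n)%C with (d n).
    assert (H := Rmult_le_compat_l _ _ _ (proj1 Hq) IH).
    simpl (q ^ S n); lra. }
assert (Hex : @ex_series C_AbsRing C_NormedModule d).
{ apply (@ex_series_le C_AbsRing C_CompleteNormedModule d _ Hd).
  apply (ex_series_scal (V := R_NormedModule)), ex_series_geom.
  rewrite Rabs_pos_eq; lra. }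
destruct Hex as [l Hl].
(* The increments telescope; the index is shifted by one, and [x 0] is zero. *)
assert (Hsum : forall n, sum_n (G := C_AbelianGroup) d n = x (S n)).
{ induction n as [|n IH].
  - rewrite sum_O; unfold d; simpl; ring.
  - rewrite sum_Sn, IH. unfold d, plus; simpl; ring. }
assert (Hlim : is_lim_seq (fun n => Cmod (x (S n) - l)%C) 0).
{ apply is_lim_seq_ext with (2 := is_series_C_dist _ _ Hl).
  intros n; f_equal; f_equal; apply Hsum. }
assert (Hlp : Cmod l <= p).
{ assert (H : Rbar_le (Cmod l) (p + 0)%R).
  { apply (is_lim_seq_le (fun _ => Cmod l) (fun n => p + Cmod (x (S n) - l)%C)).
    - intros n.
      replace l with (x (S n) + - (x (S n) - l))%C at 1 by ring.
      eapply Rle_trans; [apply Cmod_triangle|].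
      rewrite Cmod_opp; apply Rplus_le_compat_r, Hx.
    - apply is_lim_seq_const.
    - apply is_lim_seq_plus'; [apply is_lim_seq_const|exact Hlim]. }
  simpl in H; lra. }
exists l; split; [exact Hlp|].
(* Insert [x (S (S n))], which is [T (x (S n))], between [T l] and [l]; both resulting distances
   tend to 0. *)
assert (H : Rbar_le (Cmod (T l - l)%C) (q * 0 + 0)%R).
{ apply (is_lim_seq_le (fun _ => Cmod (T l - l)%C)
    (fun n => q * Cmod (x (S n) - l)%C + Cmod (x (S (S n)) - l)%C)).
  - intros n.
    replace (T l - l)%C
      with (- (x (S (S n)) - T l) + (x (S (S n)) - l))%C by ring.
    eapply Rle_trans; [apply Cmod_triangle|].
    rewrite Cmod_opp.
    apply Rplus_le_compat_r, (HL _ _ (Hx (S n)) Hlp).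
  - apply is_lim_seq_const.
  - apply is_lim_seq_plus'.
    + apply (is_lim_seq_scal_l _ q 0 Hlim).
    + apply (is_lim_seq_incr_1 (fun n => Cmod (x (S n) - l)%C)), Hlim. }
simpl in H.
assert (H0 := Cmod_ge_0 (T l - l)%C).
replace (T l) with ((T l - l) + l)%C by ring.
rewrite (Cmod_eq_0 (T l - l)%C) by lra; ring.
Qed.

(** * Uniqueness of power series coefficients *)

Lemma series_bounded_terms (u : nat -> C) (l : C) :
  @is_series C_AbsRing C_NormedModule u l ->
  exists M, forall n, Cmod (u n) <= M.
Proof.
intros H.
destruct (filterlim_bounded (V := C_NormedModule) (sum_n u)
  (ex_intro _ l H)) as [M HM].
exists (2 * M); intros n.
assert (HM' : forall k, Cmod (sum_n (G := C_AbelianGroup) u k) <= M) by exact HM.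
destruct n as [|n].
- specialize (HM' 0%nat); rewrite sum_O in HM'.
  assert (H0 := Cmod_ge_0 (u 0%nat)); lra.
- replace (u (S n)) with
    (sum_n (G := C_AbelianGroup) u (S n) + - sum_n (G := C_AbelianGroup) u n)%C
    by (rewrite sum_Sn; unfold plus; simpl; ring).
  eapply Rle_trans; [apply Cmod_triangle|].
  rewrite Cmod_opp.
  assert (H1 := HM' n); assert (H2 := HM' (S n)); lra.
Qed.

Lemma is_series_C_tail (u : nat -> C) (l : C) :
  @is_series C_AbsRing C_NormedModule u l ->
  @is_series C_AbsRing C_NormedModule (fun n => u (S n)) (l - u 0%nat)%C.
Proof.
intros H.
apply (is_series_incr_1 (V := C_NormedModule) u).
change (@is_series C_AbsRing C_NormedModule u ((l - u 0%nat) + u 0%nat)%C).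
replace ((l - u 0%nat) + u 0%nat)%C with l by ring.
exact H.
Qed.

Lemma is_series_C_scal (k : C) (u : nat -> C) (l : C) :
  @is_series C_AbsRing C_NormedModule u l ->
  @is_series C_AbsRing C_NormedModule (fun n => k * u n)%C (k * l)%C.
Proof. exact (is_series_scal (V := C_NormedModule) k u l). Qed.

Lemma is_series_C_minus (u v : nat -> C) (l m : C) :
  @is_series C_AbsRing C_NormedModule u l ->
  @is_series C_AbsRing C_NormedModule v m ->
  @is_series C_AbsRing C_NormedModule (fun n => u n - v n)%C (l - m)%C.
Proof. exact (is_series_minus (V := C_NormedModule) u v l m). Qed.

(** Convergence at 1/2 forces |c n| <= M 2^n, so at a small real t > 0 the terms of positive degree
    sum to O(t); this sum is - c 0, and t tends to 0. The point z = 0 is left out so that the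
    hypothesis survives division by z in the induction that follows. *)
Lemma zero_series_constant_term (c : nat -> C) :
  (forall z, 0 < Cmod z < 1 ->
     @is_series C_AbsRing C_NormedModule (fun n => c n * z ^ n)%C (RtoC 0)) ->
  c 0%nat = RtoC 0.
Proof.
intros H.
assert (Hh : 0 < Cmod (RtoC (1 / 2)) < 1)
  by (rewrite Cmod_R, Rabs_pos_eq; lra).
destruct (series_bounded_terms _ _ (H _ Hh)) as [M HM].
assert (HM' : forall n, Cmod (c n) <= M * 2 ^ n).
{ intros n.
  specialize (HM n).
  rewrite Cmod_mult, Cmod_pow, Cmod_R, Rabs_pos_eq in HM by lra.
  assert (H2 : 0 < 2 ^ n) by (apply pow_lt; lra).
  assert (H3 : (1 / 2) ^ n * 2 ^ n = 1)
    by (rewrite <- Rpow_mult_distr; replace (1 / 2 * 2) with 1 by lra; apply pow1).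
  assert (H4 := Rmult_le_compat_r _ _ _ (Rlt_le _ _ H2) HM).
  rewrite Rmult_assoc, H3 in H4; lra. }
assert (HM0 : 0 <= M)
  by (assert (H1 := HM' 0%nat); assert (H2 := Cmod_ge_0 (c 0%nat)); simpl in H1; lra).
(* The geometric majorant sums to 2 M t / (1 - 2 t), and 1 - 2 t >= 1/2 for t <= 1/4. *)
assert (Hb : forall t, 0 < t <= 1 / 4 -> Cmod (c 0%nat) <= 4 * M * t).
{ intros t Ht.
  assert (Hz : Cmod (RtoC t) = t) by (rewrite Cmod_R, Rabs_pos_eq; lra).
  assert (Hs : @is_series C_AbsRing C_NormedModule
    (fun n => c (S n) * RtoC t ^ (S n))%C (- c 0%nat)%C).
  { replace (- c 0%nat)%C with (RtoC 0 - c 0%nat * RtoC t ^ 0)%C by (simpl; ring).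
    apply (is_series_C_tail (fun n => c n * RtoC t ^ n)%C), H; rewrite Hz; lra. }
  assert (Hg : is_series (fun n => (M * (2 * t)) * (2 * t) ^ n)
    ((M * (2 * t)) * / (1 - 2 * t))).
  { apply (is_series_scal (V := R_NormedModule)), is_series_geom.
    rewrite Rabs_pos_eq; lra. }
  rewrite <- Cmod_opp.
  apply Rle_trans with ((M * (2 * t)) * / (1 - 2 * t)).
  - apply (is_series_Cmod_le _ _ _ _ Hs Hg).
    intros n.
    rewrite Cmod_mult, Cmod_pow, Hz.
    replace (M * (2 * t) * (2 * t) ^ n) with ((M * 2 ^ S n) * t ^ S n)
      by (rewrite Rpow_mult_distr; simpl; ring).
    apply Rmult_le_compat_r; [apply pow_le; lra|apply HM'].
  - replace (4 * M * t) with ((M * (2 * t)) * 2) by ring.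
    apply Rmult_le_compat_l; [nra|].
    rewrite <- (Rinv_inv 2).
    apply Rinv_le_contravar; lra. }
apply Cmod_eq_0, Rle_antisym; [|apply Cmod_ge_0].
apply le_epsilon; intros e He.
assert (HD : 0 < 4 * M + 1) by lra.
(* This makes 4 M t at most e; the denominator 4 M + 1 stays positive even if M = 0. *)
set (t := Rmin (1 / 4) (e / (4 * M + 1))).
assert (Ht : 0 < t) by (apply Rmin_glb_lt; [lra|apply Rdiv_lt_0_compat; lra]).
specialize (Hb t (conj Ht (Rmin_l _ _))).
assert (Ht2 : t <= e / (4 * M + 1)) by apply Rmin_r.
apply (Rmult_le_compat_r (4 * M + 1)) in Ht2; [|lra].
replace (e / (4 * M + 1) * (4 * M + 1)) with e in Ht2 by (field; lra).
nra.
Qed.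

(** Once the constant term is known to vanish, dividing by z gives a zero series with shifted
    coefficients; hence [c] is generalized in the induction. *)
Lemma zero_series_coefficients (n : nat) : forall c : nat -> C,
  (forall z, 0 < Cmod z < 1 ->
     @is_series C_AbsRing C_NormedModule (fun n => c n * z ^ n)%C (RtoC 0)) ->
  c n = RtoC 0.
Proof.
induction n as [|n IH]; intros c H.
- apply zero_series_constant_term, H.
- apply (IH (fun k => c (S k))).
  intros z Hz.
  assert (Hc0 := zero_series_constant_term c H).
  assert (Hz0 : z <> RtoC 0) by (apply Cmod_gt_0; lra).
  assert (Hs : @is_series C_AbsRing C_NormedModule
    (fun n => c (S n) * z ^ (S n))%C (RtoC 0)).
  { replace (RtoC 0) with (RtoC 0 - c 0%nat * z ^ 0)%C
      by (rewrite Hc0; simpl; ring).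
    apply (is_series_C_tail (fun n => c n * z ^ n)%C), H, Hz. }
  apply (is_series_C_scal (/ z)%C) in Hs.
  rewrite Cmult_0_r in Hs.
  apply is_series_ext with (2 := Hs).
  intros k; simpl; field; exact Hz0.
Qed.

(** [Omega_A] bounds the coefficients of some expansion, whereas [valid_radius] ranges over all of
    them; uniqueness transfers the bound. The difference of the two series is divided by z^2 to
    start at degree 0. *)
Lemma expansion_unique (f : C -> C) (a b : nat -> C) :
  expansion f a -> expansion f b -> forall n, a (n + 2)%nat = b (n + 2)%nat.
Proof.
intros Ha Hb n.
enough (H : (a (n + 2)%nat - b (n + 2)%nat)%C = RtoC 0).
{ replace (a (n + 2)%nat)
    with ((a (n + 2)%nat - b (n + 2)%nat) + b (n + 2)%nat)%C by ring.
  rewrite H; ring. }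
apply (zero_series_coefficients n
  (fun n => a (n + 2)%nat - b (n + 2)%nat)%C).
intros z Hz.
assert (Hz0 : z <> RtoC 0) by (apply Cmod_gt_0; lra).
assert (Hs := is_series_C_minus _ _ _ _ (Ha z (proj2 Hz)) (Hb z (proj2 Hz))).
apply (is_series_C_scal (/ (z ^ 2))%C) in Hs.
replace (/ (z ^ 2) * (f z - z - (f z - z)))%C with (RtoC 0) in Hs by ring.
apply is_series_ext with (2 := Hs).
intros k; rewrite Cpow_add_r; simpl; field; exact Hz0.
Qed.

(** * Estimates from the coefficient condition and the covered disk *)

Section CoefficientBounds.

Variables (f : C -> C) (a : nat -> C).
Hypothesis Hf : expansion f a.
Let c (n : nat) : R := Cmod (a (n + 2)%nat).
Hypothesis Hex : ex_series (fun n : nat => (INR (n + 2) - 1) * c n).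
Hypothesis Hsum : Series (fun n : nat => (INR (n + 2) - 1) * c n) <= 1 / 2.

Let c_ge_0 n : 0 <= c n.
Proof. apply Cmod_ge_0. Qed.

(** Termwise comparison with k p^j times the hypothesis series, using p^(n + i) <= p^j. It serves
    the weights 1, n + 2 and n + 4, with k = 1, 2 and 4 respectively, since INR (n + 2) - 1 is n +
    1. *)
Lemma weighted_series_bound (p k : R) (m : nat -> R) (j i : nat) :
  0 <= p <= 1 -> 0 <= k -> (j <= i)%nat ->
  (forall n, 0 <= m n <= k * (INR (n + 2) - 1)) ->
  ex_series (fun n => m n * c n * p ^ (n + i)) /\
  Series (fun n => m n * c n * p ^ (n + i)) <= k / 2 * p ^ j.
Proof.
intros Hp Hk Hij Hm.
assert (Hpj : 0 <= p ^ j) by (apply pow_le; lra).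
assert (Hle : forall n, 0 <= m n * c n * p ^ (n + i)
   <= (k * p ^ j) * ((INR (n + 2) - 1) * c n)).
{ intros n.
  assert (Hc := c_ge_0 n). specialize (Hm n).
  assert (Hpn : 0 <= p ^ (n + i) <= p ^ j).
  { split; [apply pow_le; lra|].
    replace (n + i)%nat with ((n + i - j) + j)%nat by lia.
    rewrite pow_add.
    assert (H1 : p ^ (n + i - j) <= 1 ^ (n + i - j)) by (apply pow_incr; lra).
    rewrite pow1 in H1; nra. }
  split.
  - apply Rmult_le_pos; [|tauto]. apply Rmult_le_pos; tauto.
  - apply Rle_trans with ((k * (INR (n + 2) - 1) * c n) * p ^ j); [|lra].
    apply Rmult_le_compat; try tauto.
    + apply Rmult_le_pos; tauto.
    + apply Rmult_le_compat_r; tauto. }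
assert (Hex' : ex_series (fun n => (k * p ^ j) * ((INR (n + 2) - 1) * c n)))
  by apply (ex_series_scal (V := R_NormedModule) (k * p ^ j) _ Hex).
split.
- apply (ex_series_le (V := R_CompleteNormedModule)) with (2 := Hex').
  intros n; unfold norm; simpl; unfold abs; simpl.
  rewrite Rabs_pos_eq; apply Hle.
- eapply Rle_trans; [apply Series_le with (1 := Hle), Hex'|].
  rewrite Series_scal_l.
  replace (k / 2 * p ^ j) with (k * p ^ j * (1 / 2)) by lra.
  apply Rmult_le_compat_l; [apply Rmult_le_pos; assumption|exact Hsum].
Qed.

(** In the usual indexing this is the sum of n |a_n| p^(n-1), the natural majorant of |f'(z) - 1| on
    |z| <= p. *)
Definition lip (p : R) : R := Series (fun n => INR (n + 2) * c n * p ^ (n + 1)).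

Lemma ex_series_lip (p : R) : 0 <= p <= 1 ->
  ex_series (fun n => INR (n + 2) * c n * p ^ (n + 1)) /\ lip p <= p.
Proof.
intros Hp.
destruct (weighted_series_bound p 2 (fun n => INR (n + 2)) 1 1 Hp) as [H1 H2].
- lra.
- lia.
- intros n; rewrite plus_INR; simpl (INR 2); assert (H := pos_INR n); lra.
- split; [exact H1|unfold lip; lra].
Qed.

Lemma tail_bound (z : C) : unit_disk z ->
  ex_series (fun n => c n * Cmod z ^ (n + 2)) /\
  Cmod (f z - z)%C <= Series (fun n => c n * Cmod z ^ (n + 2)) <=
    1 / 2 * Cmod z ^ 2.
Proof.
intros Hz; unfold unit_disk in Hz.
assert (H0 := Cmod_ge_0 z).
destruct (weighted_series_bound (Cmod z) 1 (fun _ => 1) 2 2) as [H1 H2].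
- lra.
- lra.
- lia.
- intros n; rewrite plus_INR; simpl (INR 2); assert (H := pos_INR n); lra.
- assert (Hext : forall n, 1 * c n * Cmod z ^ (n + 2) = c n * Cmod z ^ (n + 2))
    by (intros; ring).
  rewrite (Series_ext _ _ Hext) in H2.
  apply (ex_series_ext _ _ Hext) in H1.
  split; [exact H1|split; [|exact H2]].
  apply (is_series_Cmod_le _ _ _ _ (Hf z Hz) (Series_correct _ H1)).
  intros n; rewrite Cmod_mult, Cmod_pow; apply Rle_refl.
Qed.

Lemma tail_lipschitz (p : R) (z w : C) :
  p < 1 -> Cmod z <= p -> Cmod w <= p ->
  Cmod ((f z - z) - (f w - w))%C <= lip p * Cmod (z - w)%C.
Proof.
intros Hp Hz Hw.
assert (H0 := Cmod_ge_0 z).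
assert (Hs := is_series_C_minus _ _ _ _
  (Hf z (Rle_lt_trans _ _ _ Hz Hp)) (Hf w (Rle_lt_trans _ _ _ Hw Hp))).
destruct (ex_series_lip p) as [Hl _]; [lra|].
apply (is_series_Cmod_le _ _ _ _ Hs
  (is_series_scal_r (Cmod (z - w)%C) _ _ (Series_correct _ Hl))).
intros n.
replace (a (n + 2)%nat * z ^ (n + 2) - a (n + 2)%nat * w ^ (n + 2))%C
  with (a (n + 2)%nat * (z ^ (n + 2) - w ^ (n + 2)))%C by ring.
rewrite Cmod_mult; fold (c n).
replace (n + 2)%nat with (S (n + 1)) by lia.
assert (H := Rmult_le_compat_l _ _ _ (c_ge_0 n) (Cpow_lipschitz z w p (n + 1) Hz Hw)).
lra.
Qed.

Lemma image_covers_half_disk (w : C) : Cmod w < 1 / 2 -> image_of_disk f w.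
Proof.
intros Hw.
assert (Hw0 := Cmod_ge_0 w).
(* The radius p satisfies |w| + p^2/2 <= p, so z |-> w - (f z - z) preserves
   the disk of radius p. *)
set (p := 1 - sqrt (1 - 2 * Cmod w)).
assert (Hs : 0 < sqrt (1 - 2 * Cmod w)) by (apply sqrt_lt_R0; lra).
assert (Hs2 := sqrt_sqrt (1 - 2 * Cmod w)).
assert (Hp : 0 <= p < 1) by (unfold p; split; [nra|lra]).
(* Equality holds here: p is the smaller root of p^2 - 2 p + 2 |w| = 0. *)
assert (Hpw : Cmod w + p * p / 2 <= p) by (unfold p; nra).
destruct (contraction_fixed_point (fun z => w - (f z - z))%C p p)
  as [z [Hz HT]].
- lra.
- lra.
- intros z Hz.
  destruct (tail_bound z) as [_ [H1 H2]]; [unfold unit_disk; lra|].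
  assert (H0 := Cmod_ge_0 z).
  unfold Cminus at 1.
  eapply Rle_trans; [apply Cmod_triangle|].
  rewrite Cmod_opp; nra.
- intros z y Hz Hy.
  replace ((w - (f z - z)) - (w - (f y - y)))%C
    with (- ((f z - z) - (f y - y)))%C by ring.
  rewrite Cmod_opp.
  eapply Rle_trans; [apply (tail_lipschitz p); lra|].
  apply Rmult_le_compat_r; [apply Cmod_ge_0|].
  apply ex_series_lip; lra.
- exists z; split; [unfold unit_disk; lra|].
  replace w with ((w - (f z - z)) + (f z - z))%C by ring.
  rewrite HT; ring.
Qed.

(** If |w| < 1/2, the image is itself a neighbourhood of w; taking it as [P] in the definition of
    [boundary] yields a point both inside and outside the image. *)
Lemma boundary_Cmod_ge (w : C) :
  @boundary C_UniformSpace (image_of_disk f) w -> 1 / 2 <= Cmod w.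
Proof.
intros Hw.
destruct (Rle_lt_dec (1 / 2) (Cmod w)) as [H|H]; [exact H|exfalso].
destruct (Hw (image_of_disk f)) as [_ [v [Hv1 Hv2]]]; [|contradiction].
(* Balls of [C_UniformSpace] are squares, so radius e only gives modulus below sqrt 2 e. Half the
   gap suffices because sqrt 2 < 2. *)
assert (He : 0 < (1 / 2 - Cmod w) / 2) by lra.
exists (mkposreal _ He); intros v Hv.
apply image_covers_half_disk.
assert (Hd : Cmod (v - w)%C < sqrt 2 * ((1 / 2 - Cmod w) / 2))
  by exact (C_NormedModule_mixin_compat2 w v (mkposreal _ He) Hv).
assert (Hs : sqrt 2 < 2).
{ rewrite <- (sqrt_Rsqr 2) at 2 by lra.
  apply sqrt_lt_1; unfold Rsqr; lra. }
replace v with ((v - w) + w)%C by ring.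
eapply Rle_lt_trans; [apply Cmod_triangle|].
nra.
Qed.

(** Termwise differentiation is avoided: a difference quotient of f has modulus at most 1 + [lip p]
    by [tail_lipschitz], and the derivative is its limit. Taking p > |z| leaves room for the
    increment. *)
Lemma derivative_bound (p : R) (z : C) :
  @ex_derive C_AbsRing C_NormedModule f z -> Cmod z < p < 1 ->
  Cmod (C_derive f z) <= 1 + lip p.
Proof.
intros Hd Hp.
destruct (C_derive_correct f z z Hd) as [_ HD].
set (l := C_derive f z) in *.
specialize (HD z (fun P H => H)).
apply le_epsilon; intros e He.
destruct (HD (mkposreal e He)) as [d Hdom].
simpl in Hdom.
assert (Hd0 := cond_pos d).
set (h := Rmin (d / 2) ((p - Cmod z) / 2)).
assert (Hh : 0 < h) by (apply Rmin_glb_lt; lra).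
assert (Hh1 : h <= d / 2) by apply Rmin_l.
assert (Hh2 : h <= (p - Cmod z) / 2) by apply Rmin_r.
assert (Hch : Cmod (RtoC h) = h) by (rewrite Cmod_R, Rabs_pos_eq; lra).
specialize (Hdom (z + RtoC h)%C).
assert (Hy : Cmod ((z + RtoC h) - z)%C < d ->
  Cmod ((f (z + RtoC h) - f z) - ((z + RtoC h) - z) * l)%C
  <= e * Cmod ((z + RtoC h) - z)%C) by exact Hdom.
replace ((z + RtoC h) - z)%C with (RtoC h) in Hy by ring.
rewrite Hch in Hy; specialize (Hy ltac:(lra)).
assert (HL : Cmod ((f (z + RtoC h) - (z + RtoC h)) - (f z - z))%C <= lip p * h).
{ replace h with (Cmod ((z + RtoC h) - z)%C) at 3.
  - apply tail_lipschitz; [lra| |lra].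
    eapply Rle_trans; [apply Cmod_triangle|]; rewrite Hch; lra.
  - replace ((z + RtoC h) - z)%C with (RtoC h) by ring; exact Hch. }
apply (Rmult_le_reg_r h); [exact Hh|].
replace (Cmod l * h) with (Cmod (RtoC h * l)%C) by (rewrite Cmod_mult, Hch; ring).
(* The three summands are the differentiation error, the increment of f(z) - z, and the increment of
   z. *)
replace (RtoC h * l)%C with
  (- ((f (z + RtoC h) - f z) - RtoC h * l)
   + (((f (z + RtoC h) - (z + RtoC h)) - (f z - z)) + RtoC h))%C by ring.
eapply Rle_trans; [apply Cmod_triangle|].
rewrite Cmod_opp.
assert (H := Cmod_triangle ((f (z + RtoC h) - (z + RtoC h)) - (f z - z))%C (RtoC h)).
rewrite Hch in H; lra.
Qed.

(** As the derivative bound needs a radius p > |z|, the estimate is first proved with p on the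
    right, and then p decreases to |z|. *)
Lemma bohr_sum_bound (z : C) :
  @ex_derive C_AbsRing C_NormedModule f z -> unit_disk z ->
  Cmod (f z) + Cmod (C_derive f z) * Cmod z
    + Series (fun n => c n * Cmod z ^ (n + 2))
  <= 2 * Cmod z + 2 * Cmod z ^ 2.
Proof.
intros Hd Hz; unfold unit_disk in Hz.
assert (Hz0 := Cmod_ge_0 z).
assert (Hp : forall p, Cmod z < p < 1 ->
  Cmod (f z) + Cmod (C_derive f z) * Cmod z
    + Series (fun n => c n * Cmod z ^ (n + 2)) <= 2 * p + 2 * p ^ 2).
{ intros p Hp.
  destruct (tail_bound z Hz) as [E1 [B1 _]].
  assert (B2 := derivative_bound p z Hd Hp).
  destruct (ex_series_lip p) as [E2 _]; [lra|].
  destruct (weighted_series_bound p 1 (fun _ => 1) 2 2) as [E3 _].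
  { lra. }
  { lra. }
  { lia. }
  { intros n; rewrite plus_INR; simpl (INR 2); assert (H := pos_INR n); lra. }
  destruct (weighted_series_bound p 4 (fun n => INR (n + 2) + 2) 2 2)
    as [_ B3].
  { lra. }
  { lra. }
  { lia. }
  { intros n; rewrite plus_INR; simpl (INR 2); assert (H := pos_INR n); lra. }
  assert (Hfz : Cmod (f z) <= Cmod z + Cmod (f z - z)%C).
  { replace (f z) with (z + (f z - z))%C at 1 by ring; apply Cmod_triangle. }
  assert (Hle : Series (fun n => c n * Cmod z ^ (n + 2)) <=
    Series (fun n => 1 * c n * p ^ (n + 2))).
  { apply Series_le; [|exact E3].
    intros n; assert (Hc := c_ge_0 n); split.
    - apply Rmult_le_pos; [exact Hc|apply pow_le; lra].
    - rewrite Rmult_1_l.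
      apply Rmult_le_compat_l; [exact Hc|apply pow_incr; lra]. }
  (* The derivative contributes weight n + 2, while |f(z)| and the coefficient series contribute 1
     each; the merged weight is n + 4. *)
  assert (Heq : Series (fun n => (INR (n + 2) + 2) * c n * p ^ (n + 2)) =
    p * lip p + 2 * Series (fun n => 1 * c n * p ^ (n + 2))).
  { unfold lip.
    rewrite <- !Series_scal_l, <- Series_plus.
    - apply Series_ext; intros n.
      replace (p ^ (n + 2)) with (p * p ^ (n + 1)); [ring|].
      replace (n + 2)%nat with (S (n + 1)) by lia; reflexivity.
    - apply (ex_series_scal (V := R_NormedModule) p _ E2).
    - apply (ex_series_scal (V := R_NormedModule) 2 _ E3). }
  assert (Hdz : Cmod (C_derive f z) * Cmod z <= (1 + lip p) * p).
  { apply Rmult_le_compat; try apply Cmod_ge_0; [exact B2|lra]. }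
  lra. }
apply le_epsilon; intros e He.
(* For p = |z| + h < 1 the right-hand side grows by 2 h (1 + p + |z|) <= 6 h, which explains e /
   6. *)
set (h := Rmin ((1 - Cmod z) / 2) (e / 6)).
assert (Hh : 0 < h) by (apply Rmin_glb_lt; lra).
assert (Hh1 : h <= (1 - Cmod z) / 2) by apply Rmin_l.
assert (Hh2 : h <= e / 6) by apply Rmin_r.
specialize (Hp (Cmod z + h)).
nra.
Qed.

End CoefficientBounds.

(** * The inequality up to the stated radius *)

Lemma valid_radius_bohr : valid_radius ((sqrt 2 - 1) / 2).
Proof.
intros f a [[Hder [Hf0 _]] [b [Hb [Hex Hsum]]]] Ha z r Hz Hr Hrho.
assert (Hab := expansion_unique f a b Ha Hb).
rewrite (Series_ext (fun n => Cmod (a (n + 2)%nat) * r ^ (n + 2))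
  (fun n => Cmod (b (n + 2)%nat) * r ^ (n + 2)))
  by (intros n; rewrite Hab; reflexivity).
apply Rbar_le_trans with (Finite (1 / 2)).
(* The number (sqrt 2 - 1) / 2 is the positive root of 2 r + 2 r^2 = 1/2. *)
- rewrite <- Hr in *.
  assert (H := bohr_sum_bound f b Hb Hex Hsum z (Hder z Hz) Hz).
  assert (H0 := Cmod_ge_0 z).
  assert (Hs := sqrt_sqrt 2).
  simpl in H |- *; nra.
- unfold dist_to_boundary, dist_to_set.
  (* It suffices that 1/2 is a lower bound of the distances, so an empty boundary needs no separate
     case. *)
  apply (proj2 (Glb_Rbar_correct _)).
  intros d [w [Hw ->]].
  rewrite Hf0.
  replace (RtoC 0 - w)%C with (- w)%C by ring.
  rewrite Cmod_opp.
  exact (boundary_Cmod_ge f b Hb Hex Hsum w Hw).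
Qed.

(** * The extremal function and sharpness *)

Definition extremal (z : C) : C := (z + z * z / RtoC 2)%C.

Definition extremal_coef (n : nat) : C :=
  match n with 2%nat => RtoC (1 / 2) | _ => RtoC 0 end.

Lemma extremal_derive (z : C) :
  @is_derive C_AbsRing C_NormedModule extremal z (RtoC 1 + z)%C.
Proof.
split; [apply is_linear_scal_l|].
intros x Hx.
rewrite <- (is_filter_lim_locally_unique _ _ Hx); clear x Hx.
intros e.
(* The first-order remainder is exactly (y - z)^2 / 2, so [e] itself serves as the radius. *)
exists e; intros y Hy.
change (Cmod (y - z)%C < e) in Hy.
change (Cmod ((extremal y - extremal z) - (y - z) * (RtoC 1 + z))%C
  <= e * Cmod (y - z)%C).
unfold extremal.
replace ((y + y * y / RtoC 2 - (z + z * z / RtoC 2)) - (y - z) * (RtoC 1 + z))%C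
  with (/ RtoC 2 * ((y - z) * (y - z)))%C
  by (field; intros E; injection E; lra).
rewrite !Cmod_mult, Cmod_inv, Cmod_R, Rabs_pos_eq
  by first [lra | intros E; injection E; lra].
assert (H0 := Cmod_ge_0 (y - z)%C).
nra.
Qed.

Lemma is_series_head {K : AbsRing} {V : NormedModule K} (u : nat -> V) :
  (forall n, u (S n) = zero) -> is_series u (u 0%nat).
Proof.
intros H.
apply filterlim_ext with (fun _ : nat => u 0%nat); [|apply filterlim_const].
induction x as [|n IH].
- now rewrite sum_O.
- rewrite sum_Sn, <- IH, H, plus_zero_r; reflexivity.
Qed.

Lemma extremal_expansion : expansion extremal extremal_coef.
Proof.
intros z _.
replace (extremal z - z)%C with (extremal_coef 2 * z ^ 2)%C.
- apply (is_series_head (V := C_NormedModule)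
    (fun n => extremal_coef (n + 2) * z ^ (n + 2))%C).
  intros n.
  replace (S n + 2)%nat with (S (S (S n))) by lia.
  unfold zero; simpl; ring.
- unfold extremal; simpl.
  unfold Rdiv; rewrite RtoC_mult, RtoC_inv by lra.
  field; intros E; injection E; lra.
Qed.

Lemma extremal_in_Omega : Omega_A extremal.
Proof.
split; [split; [|split]|].
- intros z _; eexists; apply extremal_derive.
- unfold extremal; field; intros E; injection E; lra.
- rewrite (is_C_derive_unique _ _ _ (extremal_derive _)); ring.
- exists extremal_coef; split; [exact extremal_expansion|].
  assert (H : is_series
    (fun n : nat => (INR (n + 2) - 1) * Cmod (extremal_coef (n + 2))) (1 / 2)).
  { replace (1 / 2) with ((INR (0 + 2) - 1) * Cmod (extremal_coef (0 + 2))).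
    - apply (is_series_head (V := R_NormedModule)
        (fun n : nat => (INR (n + 2) - 1) * Cmod (extremal_coef (n + 2)))).
      intros n.
      replace (S n + 2)%nat with (S (S (S n))) by lia.
      simpl extremal_coef; rewrite Cmod_0; apply Rmult_0_r.
    - simpl; rewrite Cmod_R, Rabs_pos_eq; lra. }
  split; [eexists; exact H|].
  rewrite (is_series_unique _ _ H); lra.
Qed.

(** Since 2 [extremal] z + 1 = (z + 1)^2, the value -1/2 is taken only at z = -1, outside the open
    disk, yet it is approached along z = -1 + t with t > 0. *)
Lemma extremal_boundary :
  @boundary C_UniformSpace (image_of_disk extremal) (RtoC (- (1 / 2))).
Proof.
intros P HP.
split.
- destruct HP as [e He].
  assert (He0 := cond_pos e).
  (* The value at -1 + t is -1/2 + t^2 / 2; t <= 1 keeps the point in the disk, and with t <= e it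
     gives t^2 / 2 < e. *)
  set (t := Rmin 1 e).
  assert (Ht : 0 < t) by (apply Rmin_glb_lt; lra).
  assert (Ht1 : t <= 1) by apply Rmin_l.
  assert (Ht2 : t <= e) by apply Rmin_r.
  exists (RtoC (- (1 / 2) + t * t / 2)); split.
  + apply He; split.
    * change (Rabs ((- (1 / 2) + t * t / 2) - - (1 / 2)) < e).
      rewrite Rabs_pos_eq; nra.
    * apply ball_center.
  + exists (RtoC (- 1 + t)); split.
    * unfold unit_disk; rewrite Cmod_R; apply Rabs_def1; lra.
    * unfold extremal.
      rewrite <- RtoC_mult, <- RtoC_div, <- RtoC_plus by lra.
      f_equal; field.
- exists (RtoC (- (1 / 2))); split; [exact (locally_singleton _ _ HP)|].
  intros [z [Hz Heq]].
  assert (Hsq : ((z + RtoC 1) * (z + RtoC 1))%C = RtoC 0).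
  { replace ((z + RtoC 1) * (z + RtoC 1))%C
      with (RtoC 2 * extremal z + RtoC 1)%C
      by (unfold extremal; field; intros E; injection E; lra).
    rewrite <- Heq, <- RtoC_mult, <- RtoC_plus; f_equal; lra. }
  assert (Hm : Cmod (z + RtoC 1)%C * Cmod (z + RtoC 1)%C = 0)
    by (rewrite <- Cmod_mult, Hsq; apply Cmod_0).
  assert (Hz1 : (z + RtoC 1)%C = RtoC 0).
  { apply Cmod_eq_0; destruct (Rmult_integral _ _ Hm); assumption. }
  unfold unit_disk in Hz.
  replace z with ((z + RtoC 1) + - RtoC 1)%C in Hz by ring.
  rewrite Hz1, Cplus_0_l, Cmod_m1 in Hz; lra.
Qed.

(** At z = r > 0 the left-hand side for [extremal] is (r + r^2/2) + (1 + r) r + r^2/2 = 2 r + 2 r^2,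
    which exceeds 1/2 beyond the critical radius. *)
Lemma not_valid_radius_gt (rho : R) :
  (sqrt 2 - 1) / 2 < rho -> ~ valid_radius rho.
Proof.
intros Hrho Hv.
assert (Hs := sqrt_sqrt 2).
assert (Hs0 : 0 < sqrt 2) by (apply sqrt_lt_R0; lra).
(* The cap 9/10 keeps r inside the unit disk for large [rho] and still lies above (sqrt 2 - 1) /
   2. *)
set (r := Rmin rho (9 / 10)).
assert (Hr1 : r <= rho) by apply Rmin_l.
assert (Hr2 : r <= 9 / 10) by apply Rmin_r.
assert (Hr3 : (sqrt 2 - 1) / 2 < r) by (apply Rmin_glb_lt; [lra|nra]).
assert (Hr0 : 0 < r) by nra.
assert (Hc : Cmod (RtoC r) = r) by (rewrite Cmod_R, Rabs_pos_eq; lra).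
specialize (Hv extremal extremal_coef extremal_in_Omega extremal_expansion
  (RtoC r) r).
assert (Hd : Rbar_le (dist_to_boundary extremal) (Finite (1 / 2))).
{ unfold dist_to_boundary, dist_to_set.
  apply (proj1 (Glb_Rbar_correct _)).
  exists (RtoC (- (1 / 2))); split; [exact extremal_boundary|].
  replace (extremal (RtoC 0)) with (RtoC 0)
    by (unfold extremal; field; intros E; injection E; lra).
  rewrite <- RtoC_minus, Cmod_R, Rabs_pos_eq; lra. }
assert (H : Rbar_le (Finite (Cmod (extremal (RtoC r))
   + Cmod (C_derive extremal (RtoC r)) * Cmod (RtoC r)
   + Series (fun n => Cmod (extremal_coef (n + 2)) * r ^ (n + 2))))
   (Finite (1 / 2))).
{ eapply Rbar_le_trans; [apply Hv|exact Hd]; [unfold unit_disk; lra|exact Hc|exact Hr1]. }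
rewrite (is_C_derive_unique _ _ _ (extremal_derive _)), Hc in H.
rewrite (is_series_unique _ (Cmod (extremal_coef (0 + 2)) * r ^ (0 + 2))) in H.
2: { apply (is_series_head (V := R_NormedModule)
        (fun n => Cmod (extremal_coef (n + 2)) * r ^ (n + 2))).
     intros n.
     replace (S n + 2)%nat with (S (S (S n))) by lia.
     simpl extremal_coef; rewrite Cmod_0; apply Rmult_0_l. }
unfold extremal in H.
rewrite <- RtoC_mult, <- RtoC_div, <- !RtoC_plus in H by lra.
simpl in H.
rewrite !Cmod_R, !Rabs_pos_eq in H by nra.
nra.
Qed.

Theorem theorem7p3 :
  valid_radius ((sqrt 2 - 1) / 2) /\
  (forall rho : R, (sqrt 2 - 1) / 2 < rho -> ~ valid_radius rho).
Proof.
split; [exact valid_radius_bohr|exact not_valid_radius_gt].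
Qed.
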